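(* Let $n\geq 2$ be an integer. Each mapping $f:\mathbb{R}^n\to\mathbb{C}^n$ that preserves unit distance preserves all distances, i.e. satisfies $$\forall x,y\in\mathbb{R}^n\quad \varphi_n(f(x),f(y))=\varphi_n(x,y)=|x-y|^2,$$ provided that $f$ is continuous with respect to the product topologies on $\mathbb{R}^n$ and $\mathbb{C}^n$.
   Context: Define $\varphi_n:\mathbb{C}^n\times\mathbb{C}^n\to\mathbb{C}$ by $\varphi_n((x_1,\dots,x_n),(y_1,\dots,y_n))=(x_1-y_1)^2+\dots+(x_n-y_n)^2$ (no complex conjugation or absolute values). $\mathbb{R}^n$ is regarded as a subset of $\mathbb{C}^n$, and $|\cdot|$ is the Euclidean norm on $\mathbb{R}^n$. A map $f:\mathbb{R}^n\to\mathbb{C}^n$ preserves unit distance if for all $x,y\in\mathbb{R}^n$, $\varphi_n(x,y)=1$ implies $\varphi_n(f(x),f(y))=1$. *)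

(* Defs.v *)
From HB Require Import structures.
From mathcomp Require Import all_boot all_order all_algebra.
From mathcomp Require Import all_classical all_reals all_analysis.
From mathcomp Require Import complex.

Set Implicit Arguments.
Unset Strict Implicit.
Unset Printing Implicit Defensive.

Import Order.TTheory GRing.Theory Num.Theory.
Import numFieldNormedType.Exports.

Local Open Scope ring_scope.
Local Open Scope complex_scope.

(* The difference is squared without conjugation or modulus, so phi x y may be
   non-real and may vanish for x <> y. *)
Definition phi (R : realType) (n : nat) (x y : 'rV[R[i]]_n) : R[i] :=
  \sum_(k < n) (x 0 k - y 0 k) ^+ 2.

Definition toC (R : realType) (n : nat) (x : 'rV[R]_n) : 'rV[R[i]]_n :=
  map_mx (real_complex R) x.

(* The norm that the library puts on 'rV[R]_n is the sup norm. *)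
Definition enorm (R : realType) (n : nat) (x : 'rV[R]_n) : R :=
  Num.sqrt (\sum_(k < n) x 0 k ^+ 2).

Definition preserves_unit_distance (R : realType) (n : nat)
    (f : 'rV[R]_n -> 'rV[R[i]]_n) : Prop :=
  forall x y : 'rV[R]_n, phi (toC x) (toC y) = 1 -> phi (f x) (f y) = 1.

(* The topology of 'rV[T]_n is the product topology. The topology of C is
   carried by the alias R[i]^o, which has the one given by the modulus. *)
Definition continuousRC (R : realType) (n : nat)
    (f : 'rV[R]_n -> 'rV[R[i]]_n) : Prop :=
  continuous (f : 'rV[R]_n -> 'rV[R[i]^o]_n).

(* Main.v *)
Require Import Defs.
From HB Require Import structures.
From mathcomp Require Import all_boot all_order all_algebra.
From mathcomp Require Import all_classical all_reals all_analysis.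
From mathcomp Require Import complex.
From mathcomp Require Import ring lra.

(** Write sq for the bilinear square, so that phi x y = sq (x - y) on both
    sides, and let a map preserve q when it sends points with sq (x - y) = q to
    points with sq (f x - f y) = q.

    The rigid object is a bipyramid: n points P_i of R^n at equal mutual
    distances, and two apexes x, y equidistant from all of them.  Over C as
    over R, if the edges P_i P_j and the segment X Y have nonzero squares, the
    Gram matrix of the vectors P_i - Y is invertible; so two apexes X, Y over
    the same base either coincide or are mirror images, with
    X + Y = (2 / n) sum P_i ([apex_dichotomy]).  Hence if f preserves the two
    edge lengths of a real bipyramid with distinct apexes, then
    f x + f y = (2 / n) sum f (P_i), an affine relation between values of f,
    unless f x = f y.  Coincidence is ruled out by a third point whose distances
    to x and to y are known to f and incompatible with f x = f y.

    The relation is used to show that f carries the midpoint of two points at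
    distance 2 to the midpoint of their images.  Two successive reflections of
    a unit simplex give a homothety relation of ratio 1 + 2 / n
    ([double_reflection]); for n = 2 this is already the midpoint relation.  It
    also shows that the distance 1 + 2 / n is preserved, which excludes
    coincidence in the bipyramid with edges sqrt (2 + 2 / n) and 1, so that the
    distance 2 / n between its apexes is preserved ([rigid_small]).  By
    rescaling, all powers of 2 / n are preserved.  For n > 2 they tend to 0; in
    the bipyramids with lateral edges 1 and base edges (2 / n) ^ l the base
    shrinks to its centre, and continuity turns the relation of the apexes into
    the midpoint relation ([midpoint_limit]).

    So f is affine along unit steps on each line.  An isosceles triangle with
    legs k and base 1, cut at distance 1 from its top, shows that the distance
    1 / k is preserved; rescaling, f is affine along steps 1 / k, and by
    continuity it is affine on every half-line ([line_affine]).  As unit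
    distances are preserved, so are all distances. *)

Set Implicit Arguments.
Unset Strict Implicit.
Unset Printing Implicit Defensive.

Import Order.TTheory GRing.Theory Num.Theory.
Import numFieldNormedType.Exports.

Local Open Scope ring_scope.
Local Open Scope complex_scope.

(** * The bilinear square *)

Section Dot.
Variables (F : comPzRingType) (n : nat).
Implicit Types x y z : 'rV[F]_n.

Definition dot x y : F := \sum_(k < n) x 0 k * y 0 k.
Definition sq x : F := dot x x.

Lemma dotC x y : dot x y = dot y x.
Proof. by apply: eq_bigr => k _; rewrite mulrC. Qed.

Lemma dotDl x y z : dot (x + y) z = dot x z + dot y z.
Proof.
by rewrite /dot -big_split; apply: eq_bigr => k _; rewrite mxE mulrDl.
Qed.

Lemma dotZl a x y : dot (a *: x) y = a * dot x y.
Proof. by rewrite /dot mulr_sumr; apply: eq_bigr => k _; rewrite mxE mulrA. Qed.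

Lemma dotNl x y : dot (- x) y = - dot x y.
Proof. by rewrite -scaleN1r dotZl mulN1r. Qed.

Lemma dotDr x y z : dot x (y + z) = dot x y + dot x z.
Proof. by rewrite dotC dotDl !(dotC _ x). Qed.

Lemma dotZr a x y : dot x (a *: y) = a * dot x y.
Proof. by rewrite dotC dotZl (dotC y). Qed.

Lemma dotNr x y : dot x (- y) = - dot x y.
Proof. by rewrite dotC dotNl (dotC y). Qed.

Lemma dot_suml (I : Type) (r : seq I) (E : I -> 'rV[F]_n) y :
  dot (\sum_(i <- r) E i) y = \sum_(i <- r) dot (E i) y.
Proof.
elim: r => [|i r IH]; last by rewrite !big_cons dotDl IH.
by rewrite !big_nil /dot big1 // => k _; rewrite mxE mul0r.
Qed.

Definition dotE := (dotDl, dotDr, dotNl, dotNr, dotZl, dotZr).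

Lemma sqB x y : sq (x - y) = sq x + sq y - dot x y *+ 2.
Proof. rewrite /sq !dotE (dotC y x); ring. Qed.

Lemma sqBC x y : sq (x - y) = sq (y - x).
Proof. by rewrite !sqB (dotC y) (addrC (sq x)). Qed.

Lemma sqZ a x : sq (a *: x) = a ^+ 2 * sq x.
Proof. by rewrite /sq !dotE mulrA expr2. Qed.

End Dot.
Arguments dotE {F n}.

(** * Two apexes over an equilateral base *)

Section Apices.
Variables (F : numFieldType) (n : nat).
Hypothesis n_gt0 : (0 < n)%N.
Variables (P : 'I_n -> 'rV[F]_n) (Y : 'rV[F]_n) (a b c : F).
Hypotheses (a0 : a != 0) (c0 : c != 0).
(* In a Euclidean space this is Pythagoras: the circumradius r of the base has
   r ^ 2 = (n - 1) / (2 n) * a, and half the segment between the two apexes has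
   square b - r ^ 2 = c / 4. *)
Hypothesis cE : c = 4 * b - 2 * (n%:R - 1) / n%:R * a.
Hypothesis PP : forall i j, i != j -> sq (P i - P j) = a.
Hypothesis YP : forall i, sq (Y - P i) = b.

Let n0 : n%:R != 0 :> F. Proof. by rewrite pnatr_eq0 -lt0n. Qed.

Lemma apex_gram i j :
  dot (P i - Y) (P j - Y) = (i == j)%:R * (a / 2) + (b - a / 2).
Proof.
have Yi := YP i; have Yj := YP j; case: eqVneq => [<-|/PP].
  by rewrite -[dot _ _]/(sq _) sqBC Yi mul1r addrC subrK.
move: Yi Yj; rewrite !sqB !dotE -/(sq Y) (dotC (P i) Y) => Yi Yj Pij.
have -> : dot (P i) (P j) = (sq (P i) + sq (P j) - a) / 2.
  by rewrite -Pij; field.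
have -> : dot Y (P i) = (sq Y + sq (P i) - b) / 2 by rewrite -Yi; field.
have -> : dot Y (P j) = (sq Y + sq (P j) - b) / 2 by rewrite -Yj; field.
by rewrite mul0r; field.
Qed.

(** The Gram matrix of the n vectors P i - Y is a / 2 + (b - a / 2) J, J being the
    all-ones matrix.  Its eigenvalue on the all-ones vector is n c / 4 and its
    other eigenvalue is a / 2, so it is invertible, and the vectors P i - Y span
    the whole space. *)
Lemma apex_separates u : (forall i, dot u (P i - Y) = 0) -> u = 0.
Proof.
move=> u0; pose A : 'M[F]_n := \matrix_i (P i - Y).
pose g := b - a / 2; pose h := - (8 * g) / (a * n%:R * c).
have AAT : A *m A^T = (a / 2)%:M + const_mx g.
  apply/matrixP => i j; rewrite !mxE -[_ *+ (i == j)]mulr_natl -apex_gram.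
  by apply: eq_bigr => k _; rewrite !mxE.
(* As J ^ 2 = n J, the inverse is again a combination of 1 and J. *)
have inv : ((a / 2)%:M + const_mx g : 'M[F]_n) *m
    ((2 / a)%:M + const_mx h) = 1%:M.
  apply/matrixP => i j; rewrite mulmxDl !mulmxDr !mul_scalar_mx.
  rewrite mul_mx_scalar !mxE.
  under eq_bigr do rewrite !mxE.
  rewrite sumr_const card_ord -[_ *+ n]mulr_natl -[_ *+ (i == j)]mulr_natr /h.
  have -> : g = (n%:R * c / 4 - a / 2) / n%:R by rewrite cE /g; field.
  by field; rewrite a0 c0 n0.
move: inv; rewrite -AAT -mulmxA => /mulmx1C inv.
have uA : u *m A^T = 0.
  apply/rowP => i; rewrite !mxE -[RHS](u0 i).
  by apply: eq_bigr => k _; rewrite !mxE.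
by rewrite -(mulmx1 u) -inv !mulmxA uA !mul0mx.
Qed.

(** The products of W = X - Y with the vectors P i - Y are all equal, and so are
    those of V = 2 (Q - Y), for Q the centroid of the base.  By [apex_separates]
    W is a multiple of V, and comparing squares leaves the factors 0 and 1 only:
    X is Y or its mirror image.  This is pure algebra, hence valid over C, where
    the square of a nonzero vector may vanish. *)
Lemma apex_dichotomy X : (forall i, sq (X - P i) = b) ->
  X = Y \/ X + Y = (2 / n%:R) *: \sum_i P i /\ sq (X - Y) = c.
Proof.
move=> XP; set W := X - Y; pose V := (2 / n%:R) *: \sum_i (P i - Y).
have WE i : dot W (P i - Y) = sq W / 2.
  have := XP i; have -> : X - P i = W - (P i - Y).
    by rewrite /W opprB addrA subrK.
  rewrite sqB (_ : sq (P i - Y) = b); last by rewrite sqBC.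
  set d := dot _ _ => E; have -> : sq W = d *+ 2; last by field.
  by apply: (addIr (b - d *+ 2)); rewrite addrA E addrC subrK.
have VE i : dot V (P i - Y) = c / 2.
  rewrite /V dotZl dot_suml.
  under eq_bigr do rewrite apex_gram.
  rewrite big_split /= -mulr_suml (bigD1 i) //= eqxx big1; last first.
    by move=> j /negPf ->.
  by rewrite sumr_const card_ord -[_ *+ n]mulr_natl cE /=; field.
have sqV : sq V = c.
  rewrite /sq {2}/V dotZr dotC dot_suml.
  under eq_bigr => i _ do rewrite dotC VE.
  by rewrite sumr_const card_ord -[_ *+ n]mulr_natl; field.
have VW : c *: W = sq W *: V.
  apply/eqP; rewrite -subr_eq0; apply/eqP/apex_separates => i.
  by rewrite dotDl dotNl 2!dotZl VE WE; field.
have : sq W * (sq W - c) = 0.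
  have := congr1 (@sq F n) VW; rewrite 2!sqZ sqV => E.
  apply: (mulfI c0); rewrite mulr0; transitivity (sq W ^+ 2 * c - c ^+ 2 * sq W).
    by ring.
  by rewrite -E subrr.
move/eqP; rewrite mulf_eq0 subr_eq0 => /orP[] /eqP sW; [left|right].
  apply/eqP; rewrite -subr_eq0 -/W; apply/eqP.
  by apply: (scalerI c0); rewrite VW sW scale0r scaler0.
split=> //; have WV : W = V by apply: (scalerI c0); rewrite VW sW.
have -> : X + Y = W + 2 *: Y.
  by rewrite /W scaler_nat mulr2n addrA subrK.
rewrite WV /V sumrB sumr_const card_ord -[Y *+ n]scaler_nat scalerBr scalerA.
by rewrite divfK // subrK.
Qed.

End Apices.

(** * Regular simplices and triangles in Euclidean space *)

Section Frames.
Variables (R : rcfType) (n : nat).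
Implicit Types x y z u w : 'rV[R]_n.

Lemma sq_ge0 x : 0 <= sq x.
Proof. by apply: sumr_ge0 => k _; rewrite -expr2 sqr_ge0. Qed.

Lemma sq_eq0 x : (sq x == 0) = (x == 0).
Proof.
apply/eqP/eqP => [|->]; last by rewrite /sq /dot big1 // => k _; rewrite mxE mul0r.
move=> /psumr_eq0P x0; apply/rowP => k; rewrite mxE; apply/eqP.
by rewrite -sqrf_eq0 expr2 x0 // => j _; rewrite -expr2 sqr_ge0.
Qed.

(** The witness is the reflection in the hyperplane bisecting u and w, or the
    identity when u = w. *)
Lemma isometry_exists u w : sq u = sq w ->
  exists M : 'M[R]_n,
    (forall x y, dot (x *m M) (y *m M) = dot x y) /\ u *m M = w.
Proof.
have [-> _|uw suw] := eqVneq u w.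
  by exists 1%:M; split=> [x y|]; rewrite !mulmx1.
have [d dE] : exists d, d = u - w by exists (u - w).
have d0 : sq d != 0 by rewrite sq_eq0 dE subr_eq0.
pose M := 1%:M - (2 / sq d) *: (d^T *m d).
have ME x : x *m M = x - (2 / sq d * dot x d) *: d.
  rewrite mulmxBr mulmx1 -scalemxAr mulmxA -[_ *: d]scalerA; congr (_ - _ *: _).
  rewrite [x *m _]mx11_scalar mul_scalar_mx; congr (_ *: _).
  by rewrite mxE; apply: eq_bigr => k _; rewrite mxE.
exists M; split=> [x y|]; rewrite !ME.
  by rewrite !dotE -/(sq d) (dotC d y); field.
have -> : dot u d = sq d / 2.
  by rewrite dE sqB -suw dotDr dotNr -/(sq u); field.
have -> : 2 / sq d * (sq d / 2) = 1 by field.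
by rewrite scale1r dE opprB addrC subrK.
Qed.

(** A unit vector u and the vertices v i of a regular simplex centred at 0 in the
    hyperplane orthogonal to u; the edges of the simplex have square 2. *)
Definition frame u (v : 'I_n -> 'rV[R]_n) :=
  [/\ sq u = 1, forall i, dot u (v i) = 0,
      forall i j, dot (v i) (v j) = (i == j)%:R - n%:R^-1
    & \sum_i v i = 0].

Lemma frame_exists : (0 < n)%N -> exists u v, frame u v.
Proof.
move=> n_gt0; have n0 : n%:R != 0 :> R by rewrite pnatr_eq0 -lt0n.
(* The standard basis is a regular simplex; it only has to be centred. *)
pose o : 'rV[R]_n := const_mx 1.
pose e i : 'rV[R]_n := delta_mx 0 i.
have oo : dot o o = n%:R.
  rewrite /dot; under eq_bigr do rewrite !mxE mulr1.
  by rewrite sumr_const card_ord.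
have xe x i : dot x (e i) = x 0 i.
  rewrite /dot (bigD1 i) //= big1 ?mxE ?eqxx ?mulr1 ?addr0 // => k /negPf ki.
  by rewrite mxE ki mulr0.
have oe i : dot o (e i) = 1 by rewrite xe mxE.
have eo i : dot (e i) o = 1 by rewrite dotC.
have ee i j : dot (e i) (e j) = (i == j)%:R by rewrite xe mxE eqxx eq_sym.
have s0 : Num.sqrt n%:R != 0 :> R by rewrite sqrtr_eq0 -ltNge ltr0n.
exists ((Num.sqrt n%:R)^-1 *: o), (fun i => e i - n%:R^-1 *: o); split.
- by rewrite sqZ /sq oo exprVn sqr_sqrtr ?ler0n // mulVf.
- by move=> i; rewrite !dotE oe oo; field; rewrite n0 s0.
- by move=> i j; rewrite !dotE oe eo oo ee; field.
- rewrite sumrB sumr_const card_ord -scaler_nat scalerA mulfV // scale1r.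
  apply/eqP; rewrite subr_eq0; apply/eqP/rowP => k; rewrite summxE mxE.
  rewrite (bigD1 k) //= big1 ?mxE ?eqxx ?addr0 // => i ik.
  by rewrite mxE eqxx eq_sym (negPf ik).
Qed.

Lemma frame_through (i : 'I_n) w b c :
  sq w = b ^+ 2 + c ^+ 2 * (1 - n%:R^-1) ->
  exists u v, frame u v /\ w = b *: u + c *: v i.
Proof.
move=> sw; have [|u [v [uu uv vv v0]]] := frame_exists.
  by apply: leq_ltn_trans (ltn_ord i).
have [|M [Mdot Mw]] := @isometry_exists (b *: u + c *: v i) w.
  rewrite sw {1}/sq !dotE (dotC (v i) u) -/(sq u) uu uv vv eqxx mulr1n; ring.
exists (u *m M), (fun i => v i *m M); split; first split.
- by rewrite /sq Mdot.
- by move=> j; rewrite Mdot.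
- by move=> j k; rewrite Mdot.
- by rewrite -mulmx_suml v0 mul0mx.
- by rewrite -Mw mulmxDl !scalemxAl.
Qed.

(** The last hypothesis is Heron's condition for a triangle with squared sides
    c ^ 2, p and q.  The dimension enters because the third vertex is sought in
    a plane through x and y, spanned by x - y and a vertex of the simplex
    orthogonal to it. *)
Lemma triangle_exists x y c p q : (2 <= n)%N -> 0 < c ->
  sq (x - y) = c ^+ 2 -> (c ^+ 2 + q - p) ^+ 2 <= 4 * c ^+ 2 * q ->
  exists z, sq (z - x) = p /\ sq (z - y) = q.
Proof.
move=> n2 c0 xy heron; have n_gt0 : (0 < n)%N by exact: ltnW.
pose i := Ordinal n_gt0.
have [|u [v [[uu uv vv _] wE]]] := @frame_through i (x - y) c 0.
  by rewrite xy expr0n mul0r addr0.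
rewrite scale0r addr0 in wE.
have n1 : 0 < 1 - n%:R^-1 :> R.
  by rewrite subr_gt0 invf_lt1 ?ltr1n ?ltr0n.
(* t is the abscissa, along x - y from y, of the foot of the altitude at z. *)
pose t := (c ^+ 2 + q - p) / (2 * c).
have c_neq0 : c != 0 by rewrite gt_eqF.
have tq : 0 <= (q - t ^+ 2) / (1 - n%:R^-1).
  apply: divr_ge0; last exact: ltW.
  rewrite subr_ge0 /t expr_div_n ler_pdivrMr ?exprn_gt0 ?mulr_gt0 //.
  by apply: le_trans heron _; rewrite le_eqVlt; apply/orP; left; apply/eqP; ring.
pose s := Num.sqrt ((q - t ^+ 2) / (1 - n%:R^-1)).
have sE : s ^+ 2 * (1 - n%:R^-1) = q - t ^+ 2.
  by rewrite sqr_sqrtr // divfK // gt_eqF.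
have sqE a : sq (a *: u + s *: v i) = a ^+ 2 + q - t ^+ 2.
  rewrite {1}/sq !dotE (dotC (v i) u) -/(sq u) uu uv vv eqxx mulr1n.
  by rewrite -[RHS]addrA -sE; ring.
exists (y + (t *: u + s *: v i)); split.
  have -> : y + (t *: u + s *: v i) - x = (t - c) *: u + s *: v i.
    by rewrite addrAC -[y - x]opprB wE scalerBl addrA (addrC (- _)).
  by rewrite sqE /t; field.
by rewrite addrC addKr sqE addrAC subrr add0r.
Qed.
End Frames.

(** The case i = j is meaningful: with d = 0 it gives the square of a combination
    of u and one vertex only. *)
Lemma frame_sq (R : rcfType) n (u : 'rV[R]_n) v b c d i j : frame u v ->
  sq (b *: u + c *: v i + d *: v j) =
    b ^+ 2 + c ^+ 2 + d ^+ 2 + (i == j)%:R * (c * d *+ 2) - (c + d) ^+ 2 / n%:R.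
Proof.
case=> uu uv vv _; rewrite {1}/sq !dotE -/(sq u) !(dotC (v _) u) uu !uv !vv.
by rewrite !eqxx (eq_sym j i) !mulr1n; ring.
Qed.

(** * Distances forced by the unit distance *)

Section Preserved.
Variables (R : realType) (n : nat).
Hypothesis n_ge2 : (2 <= n)%N.
Implicit Types (f : 'rV[R]_n -> 'rV[R[i]]_n) (x y z w m : 'rV[R]_n).

Let n_gt0 : (0 < n)%N. Proof. exact: ltnW. Qed.
Let N_gt0 : 0 < n%:R :> R. Proof. by rewrite ltr0n. Qed.
Let N_neq0 : n%:R != 0 :> R. Proof. by rewrite gt_eqF. Qed.
Let N_ge2 : 2 <= n%:R :> R. Proof. by rewrite ler_nat. Qed.

Definition preserves f (q : R) :=
  forall x y, sq (x - y) = q -> sq (f x - f y) = q%:C.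

Definition rescale (a : R) f x := (a^-1)%:C *: f (a *: x).

Lemma preserves_rescale f a q : a != 0 ->
  preserves (rescale a f) q <-> preserves f (a ^+ 2 * q).
Proof.
move=> a0; have aC : a%:C != 0 by rewrite fmorph_eq0.
have E x y : sq (rescale a f x - rescale a f y) =
    (a%:C)^-1 ^+ 2 * sq (f (a *: x) - f (a *: y)).
  by rewrite /rescale -scalerBr sqZ fmorphV.
split=> fq x y xy.
  have := fq (a^-1 *: x) (a^-1 *: y).
  rewrite E !scalerA !mulfV // !scale1r -scalerBr sqZ xy => H.
  by rewrite rmorphM rmorphXn /= -H; field.
rewrite E (fq _ _ (_ : sq _ = a ^+ 2 * q)) -?scalerBr ?sqZ ?xy //.
by rewrite rmorphM rmorphXn /=; field.
Qed.

(** The quantification over all maps is what makes these squares closed under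
    products: what holds for f also holds for its rescalings. *)
Definition rigid (q : R) := forall f, preserves f 1 -> preserves f q.

Lemma rigidM p q : 0 < p -> rigid p -> rigid q -> rigid (p * q).
Proof.
move=> p0 rp rq f f1; have a0 : Num.sqrt p != 0 by rewrite sqrtr_eq0 -ltNge.
have pE : p = Num.sqrt p ^+ 2 by rewrite sqr_sqrtr // ltW.
rewrite pE; apply/(preserves_rescale _ _ a0)/rq/(preserves_rescale _ _ a0).
by rewrite mulr1 -pE; apply: rp.
Qed.

Lemma rigidX p l : 0 < p -> rigid p -> rigid (p ^+ l).
Proof.
move=> p0 rp; elim: l => [|l IH]; first by move=> f; rewrite expr0.
by rewrite exprS; apply: rigidM.
Qed.

Definition bipyramid (P : 'I_n -> 'rV[R]_n) x y (a b : R) :=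
  [/\ forall i j, i != j -> sq (P i - P j) = a,
      forall i, sq (x - P i) = b & forall i, sq (y - P i) = b].

Lemma bipyramid_frame u v a b s t m : frame u v -> a = 2 * t ^+ 2 ->
  b = s ^+ 2 + t ^+ 2 * (1 - n%:R^-1) ->
  bipyramid (fun i => m + t *: v i) (m + s *: u) (m - s *: u) a b.
Proof.
move=> F aE bE; split=> [i j /negPf ij|i|i].
- have -> : m + t *: v i - (m + t *: v j) = 0 *: u + t *: v i + (- t) *: v j.
    by rewrite scale0r add0r scaleNr opprD addrACA subrr add0r.
  by rewrite (frame_sq _ _ _ _ _ F) ij mulr0n aE; field.
- have -> : m + s *: u - (m + t *: v i) = s *: u + (- t) *: v i + 0 *: v i.
    by rewrite scale0r addr0 scaleNr opprD addrACA subrr add0r.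
  by rewrite (frame_sq _ _ _ _ _ F) bE; field.
- have -> : m - s *: u - (m + t *: v i) = (- s) *: u + (- t) *: v i + 0 *: v i.
    by rewrite scale0r addr0 !scaleNr opprD addrACA subrr add0r.
  by rewrite (frame_sq _ _ _ _ _ F) bE; field.
Qed.

Lemma bipyramid_exists x y a b c : 0 < a -> 0 < c -> sq (x - y) = c ->
  c = 4 * b - 2 * (n%:R - 1) / n%:R * a -> exists P, bipyramid P x y a b.
Proof.
move=> a0 c0 xy cE; pose s := Num.sqrt c; pose t := Num.sqrt (a / 2).
have sE : s ^+ 2 = c by rewrite sqr_sqrtr // ltW.
have tE : t ^+ 2 = a / 2 by rewrite sqr_sqrtr // divr_ge0 // ltW.
have [|u [v [F wE]]] := @frame_through _ _ (Ordinal n_gt0) (x - y) s 0.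
  by rewrite xy sE expr0n mul0r addr0.
rewrite scale0r addr0 in wE.
have := @bipyramid_frame u v a b (s / 2) t (2^-1 *: (x + y)) F.
have -> : (s / 2) *: u = 2^-1 *: (x - y) by rewrite wE scalerA mulrC.
rewrite -scalerDr -scalerBr.
have -> : x + y + (x - y) = 2 *: x by rewrite addrACA subrr addr0 scaler_nat.
have -> : x + y - (x - y) = 2 *: y.
  by apply/rowP => k; rewrite !mxE; ring.
rewrite !scalerA mulVf ?pnatr_eq0 // !scale1r => H; eexists; apply: H.
  by rewrite tE; field.
by rewrite tE expr_div_n sE cE; field.
Qed.

(** [apex_dichotomy] for the image of a bipyramid: since the image lies in C^n,
    the coincidence of the images of the apexes is not excluded by c <> 0. *)
Lemma image_apices f a b c P x y : preserves f a -> preserves f b ->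
  0 < a -> 0 < c -> c = 4 * b - 2 * (n%:R - 1) / n%:R * a ->
  bipyramid P x y a b ->
  f x = f y \/
  f x + f y = (2 / n%:R) *: \sum_i f (P i) /\ sq (f x - f y) = c%:C.
Proof.
move=> fa fb a0 c0 cE [PP xP yP].
apply: (@apex_dichotomy _ _ n_gt0 (f \o P) (f y) a%:C b%:C c%:C) => /=.
- by rewrite fmorph_eq0 gt_eqF.
- by rewrite fmorph_eq0 gt_eqF.
- by rewrite cE !(rmorphB, rmorphM, fmorphV, rmorph_nat, rmorph1).
- by move=> i j /PP /fa.
- by move=> i; apply/fb/yP.
- by move=> i; apply/fb/xP.
Qed.

(** For a <= 1 the square c exceeds 1, so there is a point z at distance 1 from y
    and at the same distance from x as y.  If f x = f y, then f z and f x are at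
    square 1, whereas [image_apices] applied to z and x only allows 0 and c. *)
Lemma thin_bipyramid f a P x y (c := 4 - 2 * (n%:R - 1) / n%:R * a) :
  preserves f 1 -> preserves f a -> 0 < a <= 1 ->
  bipyramid P x y a 1 -> sq (x - y) = c ->
  f x + f y = (2 / n%:R) *: \sum_i f (P i) /\ sq (f x - f y) = c%:C.
Proof.
move=> f1 fa /andP[a0 a1] B xy.
have cE : c = 4 * 1 - 2 * (n%:R - 1) / n%:R * a by rewrite mulr1.
have c1 : 1 < c.
  have : (n%:R - 1) / n%:R * a < 1.
    rewrite mulrAC ltr_pdivrMr // mul1r; have := N_ge2; nra.
  rewrite /c; nra.
have c0 : 0 < c by apply: lt_trans c1.
case: (image_apices fa f1 a0 c0 cE B) => // fxy.
have [|||z [zx zy]] := @triangle_exists _ _ x y (Num.sqrt c) c 1 n_ge2.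
- by rewrite sqrtr_gt0.
- by rewrite sqr_sqrtr // ltW.
- by rewrite sqr_sqrtr ?ltW //; nra.
have [Q BQ] := bipyramid_exists a0 c0 zx cE.
have fzx : sq (f z - f x) = 1 by rewrite fxy (f1 _ _ zy).
case: (image_apices fa f1 a0 c0 cE BQ) => [fzx'|[_]].
  move: fzx; rewrite fzx' subrr /sq /dot big1 => [/eqP|k _]; last by rewrite mxE mul0r.
  by rewrite eq_sym oner_eq0.
rewrite fzx => /(fmorph_inj (real_complex R)) c1'.
by move: c1; rewrite -c1' ltxx.
Qed.

(* The squared distance between the apexes of two unit simplices glued along a
   facet, that is, the square of twice their altitude. *)
Local Notation opposite_sq := (2 * (n%:R + 1) / n%:R : R).

Lemma opposite_sqE : 4 - 2 * (n%:R - 1) / n%:R * 1 = opposite_sq.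
Proof. by field. Qed.

Lemma unit_bipyramid f P x y : preserves f 1 -> bipyramid P x y 1 1 ->
  sq (x - y) = opposite_sq -> f x + f y = (2 / n%:R) *: \sum_i f (P i).
Proof.
move=> f1 B xy; have [||-> _] // := thin_bipyramid f1 f1 _ B.
- by rewrite ltr01 lexx.
- by rewrite xy opposite_sqE.
Qed.

Lemma rigid_double_altitude : rigid opposite_sq.
Proof.
move=> f f1 x y xy.
have d0 : 0 < opposite_sq by rewrite divr_gt0 // mulr_gt0 // addr_gt0.
have [|P B] := @bipyramid_exists x y 1 1 opposite_sq ltr01 d0 xy.
  by rewrite [4 * 1]mulr1 opposite_sqE.
have [||_] := thin_bipyramid f1 f1 _ B.
- by rewrite ltr01 lexx.
- by rewrite xy opposite_sqE.
by rewrite opposite_sqE.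
Qed.

Local Notation lambda := (1 + 2 / n%:R : R).

(** Let x, P be a unit simplex.  Reflect x in the facet P to x', then P i in the
    facet where x' replaces it, to x''.  Both reflections are affine relations
    preserved by f, and subtracting them gives
    x'' - x = (1 + 2 / n) (x' - P i), for the points and for their images. *)
Lemma double_reflection f x w (i : 'I_n) : preserves f 1 -> sq w = 1 ->
  exists P x',
    [/\ x' = P i + w, x + x' = (2 / n%:R) *: \sum_j P j,
        f x + f x' = (2 / n%:R) *: \sum_j f (P j)
      & f (x + lambda *: w) - f x = lambda%:C *: (f x' - f (P i))].
Proof.
move=> f1 sw.
(* s is the altitude of the unit simplex, and t scales the edges of the frame to
   length 1; x' - P i is then s u - t v i. *)
pose s := Num.sqrt ((n%:R + 1) / (2 * n%:R) : R).
pose t := Num.sqrt (2^-1 : R).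
have sE : s ^+ 2 = (n%:R + 1) / (2 * n%:R).
  by rewrite sqr_sqrtr // divr_ge0 // ?addr_ge0 ?mulr_ge0 // ltW.
have tE : t ^+ 2 = 2^-1 by rewrite sqr_sqrtr // invr_ge0.
have [|u [v [F wE]]] := @frame_through _ _ i w s (- t).
  by rewrite sw sE sqrrN tE; field.
have [uu _ _ v0] := F.
clearbody s t.
pose P j := x + s *: u + t *: v j.
pose x' := x + (s *+ 2) *: u.
pose x'' := x + lambda *: w.
pose Q j := if j == i then x' else P j.
have sqE (y : 'rV[R]_n) b c d j k : y = b *: u + c *: v j + d *: v k ->
    sq y = b ^+ 2 + c ^+ 2 + d ^+ 2 + (j == k)%:R * (c * d *+ 2)
           - (c + d) ^+ 2 / n%:R.
  by move=> ->; rewrite (frame_sq _ _ _ _ _ F).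
have norm := (sqrrN, exprMn, sE, tE).
have BP : bipyramid P x x' 1 1.
  have := @bipyramid_frame u v 1 1 s t (x + s *: u) F.
  have -> : x + s *: u + s *: u = x' by rewrite /x' -addrA -scalerDl -mulr2n.
  rewrite addrK => -[|| ? ? ?]; first by rewrite tE mulfV ?pnatr_eq0.
    by rewrite sE tE; field.
  by split.
have [PP xP x'P] := BP.
have x''P j : j != i -> sq (x'' - P j) = 1.
  rewrite eq_sym => /negPf ij.
  rewrite (@sqE _ ((2 / n%:R) * s) (- (lambda * t)) (- t) i j).
    rewrite ij mulr0n mul0r addr0 !norm.
    have -> : (- (lambda * t) - t) ^+ 2 = (lambda + 1) ^+ 2 * t ^+ 2 by ring.
    by rewrite tE; field.
  by apply/rowP => k; rewrite /x'' /P wE !mxE; field.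
have x''x' : sq (x'' - x') = 1.
  rewrite (@sqE _ ((lambda - 2) * s) (- (lambda * t)) 0 i i).
    by rewrite addr0 !norm; field.
  by apply/rowP => k; rewrite /x'' /x' wE !mxE; field.
have BQ : bipyramid Q (P i) x'' 1 1.
  split=> [j k|j|j]; rewrite /Q.
  - case: (eqVneq j i) => [->|ji]; case: (eqVneq k i) => [_|ki] jk //.
    + by rewrite sqBC x'P.
    + exact: PP.
  - have [_|ji] := eqVneq j i; first by rewrite sqBC x'P.
    by rewrite PP // eq_sym.
  - by case: (eqVneq j i) => [_|/x''P].
have fxx' : f x + f x' = (2 / n%:R) *: \sum_j f (P j).
  apply: (unit_bipyramid f1 BP).
  have -> : x - x' = - (s *+ 2) *: u by rewrite /x' opprD addNKr scaleNr.
  by rewrite sqZ uu sqrrN mulr1 -[s *+ 2]mulr_natr exprMn sE; field.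
have fQ : f (P i) + f x'' = (2 / n%:R) *: \sum_j f (Q j).
  apply: (unit_bipyramid f1 BQ).
  rewrite (@sqE _ (- (2 / n%:R) * s) ((1 + lambda) * t) 0 i i).
    by rewrite addr0 !norm; field.
  by apply/rowP => k; rewrite /x'' /P wE !mxE; field.
exists P, x'; split=> //.
- by rewrite wE; apply/rowP => k; rewrite /x' /P !mxE; ring.
- rewrite /P !big_split /= -[X in _ *: (_ + X)]scaler_sumr v0 scaler0 addr0 !sumr_const card_ord.
  by apply/rowP => k; rewrite /x' !(mxE, mulmxnE); field.
- have SQ : \sum_j f (Q j) = \sum_j f (P j) - f (P i) + f x'.
    rewrite (bigD1 i) //= [in RHS](bigD1 i) //= /Q eqxx addrC; congr (_ + _).
    rewrite [RHS]addrC addKr; apply: eq_bigr => j /negPf ji; by rewrite ji.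
  apply/rowP => k; move/rowP/(_ k): fQ; move/rowP/(_ k): fxx'; rewrite SQ.
  rewrite !mxE; set S := fun_of_matrix (\sum_j _) 0 k => e1 e2.
  rewrite !(rmorphD, rmorph1, fmorph_div, rmorph_nat).
  have -> : f (x + (1 + 2 / n%:R) *: w) 0 k = f x'' 0 k by [].
  rewrite -(addKr (f (P i) 0 k) (f x'' 0 k)) e2 -(addrK (f x' 0 k) (f x 0 k)) e1.
  by field; rewrite pnatr_eq0 -lt0n.
Qed.

Lemma rigid_lambda : rigid (lambda ^+ 2).
Proof.
move=> f f1 x y xy; have l0 : lambda != 0.
  by rewrite gt_eqF // addr_gt0 // divr_gt0.
have [|P [x' [x'E _ _ fE]]] :=
  @double_reflection f y (lambda^-1 *: (x - y)) (Ordinal n_gt0) f1.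
  by rewrite sqZ xy -exprMn mulVf // expr1n.
move: fE; rewrite scalerA mulfV // scale1r [y + _]addrC subrK => ->.
rewrite sqZ f1 ?mulr1 ?rmorphXn //.
by rewrite x'E [P _ + _]addrC addrK sqZ xy -exprMn mulVf // expr1n.
Qed.

(** These are the apexes over a base with edges of square 2 + 2 / n and lateral
    edges 1.  On the line y x, one unit beyond x, lies a point z at distance 1 from x
    and 1 + 2 / n from y; as both distances are preserved and differ, f x <> f y. *)
Lemma rigid_small : rigid ((2 / n%:R : R) ^+ 2).
Proof.
move=> f f1 x y xy.
have s0 : 0 < (2 / n%:R : R) ^+ 2 by rewrite exprn_gt0 // divr_gt0.
have d0 : 0 < 2 * (n%:R + 1) / n%:R :> R.
  by rewrite divr_gt0 // mulr_gt0 // addr_gt0.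
have cE : (2 / n%:R) ^+ 2 =
    4 * 1 - 2 * (n%:R - 1) / n%:R * (2 * (n%:R + 1) / n%:R) :> R by field.
have [P B] := bipyramid_exists d0 s0 xy cE.
have [fxy|[_ //]] := image_apices (rigid_double_altitude f1) f1 d0 s0 cE B.
pose z := x + (n%:R / 2) *: (x - y).
have zx : sq (f z - f x) = 1.
  by apply: f1; rewrite /z addrC addKr sqZ xy; field.
have zy : sq (f z - f y) = (lambda ^+ 2)%:C.
  apply: rigid_lambda => //; have -> : z - y = (n%:R / 2 + 1) *: (x - y).
    by rewrite /z scalerDl scale1r addrAC addrC.
  by rewrite sqZ xy; field.
move: zy; rewrite -fxy zx -[1](rmorph1 (real_complex R)).
move=> /(fmorph_inj (real_complex R)) l1.
have : 1 < lambda ^+ 2 by rewrite exprn_egt1 // ltrDl divr_gt0.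
by rewrite -l1 ltxx.
Qed.

End Preserved.

(** * Continuous maps *)

Section Continuity.
Local Open Scope classical_set_scope.

Lemma continuous_coord (R : realType) n (f : 'rV[R]_n -> 'rV[R[i]]_n) k :
  continuousRC f -> continuous (fun x => f x 0 k : R[i]^o).
Proof.
move=> fc x; have h := fc x.
apply: (@continuous_comp _ 'rV[R[i]^o]_n R[i]^o f (fun M => M 0 k)) => //.
exact: (@coord_continuous R[i]).
Qed.

Lemma continuous_rescale (R : realType) n (f : 'rV[R]_n -> 'rV[R[i]]_n) a :
  continuousRC f -> continuousRC (rescale a f).
Proof.
move=> fc x; rewrite /rescale.
apply: (@cvgZl_tmp R[i] 'rV[R[i]^o]_n); first exact: (nbhs_filter x).
have ax : (fun y : 'rV[R]_n => a *: y) @ x --> a *: x.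
  exact: scaler_continuous.
exact: (cvg_comp _ (f : 'rV[R]_n -> 'rV[R[i]^o]_n) ax (fc (a *: x))).
Qed.

Definition midpoint_preserving (R : realType) n (f : 'rV[R]_n -> 'rV[R[i]]_n) :=
  forall z w, sq w = 1 -> f (z + w) + f (z - w) = 2 *: f z.

(** In the plane the facet P is a segment and x, P 0, x', P 1 is a rhombus.  Hence
    P 1 - x = x' - P 0, and the ratio in [double_reflection] is 2: the relation
    says that P 1 is the midpoint of x and x'' and that f respects it. *)
Lemma midpoint_dim2 (R : realType) (f : 'rV[R]_2 -> 'rV[R[i]]_2) :
  preserves f 1 -> midpoint_preserving f.
Proof.
move=> f1 z w sw.
have [P [x' [x'E PE fE ff]]] := double_reflection (leqnn 2) (z - w) ord0 f1 sw.
have two (F : fieldType) (c : F) : (2 != 0 :> F) -> 2 / 2 * c = c.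
  by move=> h; rewrite mulfV // mul1r.
have Pz : P ord_max = z.
  apply/rowP => k; move/rowP/(_ k): PE; rewrite x'E !mxE two ?pnatr_eq0 //.
  rewrite !(big_ord_recl, big_ord0) !mxE addr0.
  have -> : lift ord0 ord0 = ord_max :> 'I_2 by apply: val_inj.
  move=> e; apply: (addrI (P ord0 0 k)); rewrite -e; ring.
apply/rowP => k; move/rowP/(_ k): fE; move/rowP/(_ k): ff.
rewrite !mxE two ?pnatr_eq0 // !(big_ord_recl, big_ord0) !mxE addr0.
have -> : lift ord0 ord0 = ord_max :> 'I_2 by apply: val_inj.
rewrite Pz.
have -> : z - w + (1 + 2 / 2) *: w = z + w.
  by apply/rowP => j; rewrite !mxE; field.
rewrite !(rmorphD, rmorph1, fmorph_div, rmorph_nat) divff ?pnatr_eq0 // => e1 e2.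
rewrite -(subrK (f (z - w) 0 k) (f (z + w) 0 k)) e1.
by rewrite -[f x' 0 k](addKr (f (z - w) 0 k)) e2; ring.
Qed.

(** Thin bipyramids with lateral edges 1 and base edges (2 / n) ^ l, centred at z
    with axis w: as l grows the base collapses to z and the apexes tend to
    z + w and z - w. *)
Lemma midpoint_limit (R : realType) n (f : 'rV[R]_n -> 'rV[R[i]]_n) :
  (2 < n)%N -> continuousRC f -> preserves f 1 -> midpoint_preserving f.
Proof.
move=> n3 fc f1 z w sw; have n2 : (1 < n)%N := ltnW n3.
have n0 : 0 < n%:R :> R by rewrite ltr0n ltnW.
have [|u [v [F wE]]] := @frame_through R n (Ordinal (ltnW n2)) w 1 0.
  by rewrite sw expr1n expr0n mul0r addr0.
rewrite scale1r scale0r addr0 in wE; rewrite wE.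
pose r : R := 2 / n%:R.
(* The base vertices are z + t l v j; the frame has edges of square 2, whence the
   factor sqrt (1 / 2). *)
pose t := geometric (Num.sqrt 2^-1) r : R^nat.
pose s l := Num.sqrt (1 - t l ^+ 2 * (1 - n%:R^-1)).
have r01 : 0 < r < 1 by rewrite divr_gt0 //= ltr_pdivrMr // mul1r ltr_nat.
have tE l : 2 * t l ^+ 2 = (r ^+ 2) ^+ l.
  by rewrite /t /= exprMn sqr_sqrtr ?invr_ge0 // exprAC; field.
have a1 l : 0 < (r ^+ 2) ^+ l <= 1.
  case/andP: r01 => r0 r1; rewrite !exprn_gt0 //=.
  rewrite exprn_ile1 ?exprn_ge0 ?(ltW r0) //.
  by rewrite exprn_ile1 // ltW.
have sE l : s l ^+ 2 = 1 - t l ^+ 2 * (1 - n%:R^-1).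
  rewrite sqr_sqrtr //; have /andP[a0] := a1 l; rewrite -tE => a1l.
  have n1 : 0 < n%:R^-1 :> R by rewrite invr_gt0.
  have tl : 0 <= t l ^+ 2 by exact: sqr_ge0.
  nra.
have fE l : f (z + s l *: u) + f (z - s l *: u) =
    r%:C *: \sum_j f (z + t l *: v j).
  have fa : preserves f ((r ^+ 2) ^+ l).
    apply: rigidX f1; last exact: rigid_small.
    by case/andP: r01 => r0 _; rewrite exprn_gt0.
  have B : bipyramid (fun i => z + t l *: v i)
      (z + s l *: u) (z - s l *: u) ((r ^+ 2) ^+ l) 1.
    apply: (bipyramid_frame n2 _ F); first by rewrite tE.
    by rewrite sE subrK.
  have [|-> _] := thin_bipyramid n2 f1 fa (a1 l) B.
    have -> : z + s l *: u - (z - s l *: u) = (2 * s l) *: u.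
      by apply/rowP => k; rewrite !mxE; ring.
    case: F => uu _ _ _; rewrite sqZ uu mulr1 exprMn sE -tE; field.
    by rewrite gt_eqF.
  by rewrite fmorph_div !rmorph_nat.
have t0 : t @ \oo --> (0 : R).
  by apply: cvg_geometric; case/andP: r01 => r0 r1; rewrite ger0_norm // ltW.
have s1 : s @ \oo --> (1 : R).
  have -> : 1 = Num.sqrt (1 - 0 * 0 * (1 - n%:R^-1)) :> R.
    by rewrite !mul0r subr0 sqrtr1.
  apply: (cvg_comp (fun l => 1 - t l ^+ 2 * (1 - n%:R^-1)) Num.sqrt);
    last exact: sqrt_continuous.
  apply: cvgB; first exact: cvg_cst.
  by apply: cvgMr_tmp; apply: cvgM.
apply/rowP => k.
have lim (g : nat -> 'rV[R]_n) x : g @ \oo --> x ->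
    (fun l => f (g l) 0 k : R[i]^o) @ \oo --> (f x 0 k : R[i]^o).
  move=> gx; apply: (cvg_comp g (fun x => f x 0 k : R[i]^o) gx).
  exact: continuous_coord.
have line (a : R^nat) (b : R) (x : 'rV[R]_n) : a @ \oo --> b ->
    (fun l => z + a l *: x) @ \oo --> z + b *: x.
  by move=> ab; apply: cvgD; [exact: cvg_cst | apply: cvgZr_tmp].
have L : (fun l => f (z + s l *: u) 0 k + f (z - s l *: u) 0 k : R[i]^o) @ \oo -->
   (f (z + u) 0 k + f (z - u) 0 k : R[i]^o).
  apply: cvgD; apply: lim; first by rewrite -{2}[u]scale1r; apply: line.
  rewrite -scaleN1r; under eq_fun do rewrite -scaleNr.
  by apply: line; apply: cvgN.
have L' : (fun l => r%:C *: \sum_j f (z + t l *: v j) 0 k : R[i]^o) @ \oo -->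
   (r%:C *: \sum_(j < n) f z 0 k : R[i]^o).
  apply: (@cvgZl_tmp R[i] R[i]^o); apply: cvg_big => [|j _].
    exact: (@pseudometric_normed_Zmodule.add_continuous _ R[i]^o).
  by apply: lim; rewrite -[X in _ --> X]addr0 -(scale0r (v j)); apply: line.
have fun_eq : (fun l => f (z + s l *: u) 0 k + f (z - s l *: u) 0 k : R[i]^o) =
    (fun l => r%:C *: \sum_j f (z + t l *: v j) 0 k : R[i]^o).
  by apply: funext => l; move/rowP/(_ k): (fE l); rewrite !mxE summxE.
rewrite fun_eq in L; rewrite !mxE.
have := cvg_unique (@norm_hausdorff _ R[i]^o) L L'.
rewrite sumr_const card_ord => ->; rewrite -[_ *: _]/(_ * _) -[_ *+ n]mulr_natl.
rewrite fmorph_div !rmorph_nat; field.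
by rewrite pnatr_eq0 -lt0n ltnW.
Qed.

Lemma unit_midpoint (R : realType) n (f : 'rV[R]_n -> 'rV[R[i]]_n) :
  (2 <= n)%N -> continuousRC f -> preserves f 1 -> midpoint_preserving f.
Proof.
rewrite leq_eqVlt => /orP[/eqP n2|n3]; last exact: midpoint_limit.
by case: n / n2 f => f _; apply: midpoint_dim2.
Qed.

Lemma integer_steps (R : realType) n (f : 'rV[R]_n -> 'rV[R[i]]_n) z w k :
  midpoint_preserving f -> sq w = 1 ->
  f (z + k%:R *: w) - f z = k%:R *: (f (z + w) - f z).
Proof.
move=> mid sw.
suff H : f (z + k%:R *: w) - f z = k%:R *: (f (z + w) - f z) /\
   f (z + k.+1%:R *: w) - f z = k.+1%:R *: (f (z + w) - f z) by case: H.
elim: k => [|k [IH1 IH2]]; first by rewrite !scale0r !addr0 subrr !scale1r.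
split=> //; have := mid (z + k.+1%:R *: w) w sw.
have -> : z + k.+1%:R *: w + w = z + k.+2%:R *: w.
  by rewrite -addrA -[X in _ + (_ + X)]scale1r -scalerDl natr1.
have -> : z + k.+1%:R *: w - w = z + k%:R *: w.
  by rewrite -natr1 scalerDl scale1r addrA addrK.
move=> E; apply/rowP => j; move/rowP/(_ j): E; move/rowP/(_ j): IH1.
move/rowP/(_ j): IH2; rewrite !mxE => e1 e2 e3.
rewrite -[f _ 0 j](addrK (f (z + k%:R *: w) 0 j)) e3.
rewrite -[f (z + k.+1%:R *: w) 0 j](subrK (f z 0 j)) e1.
by rewrite -[f (z + k%:R *: w) 0 j](subrK (f z 0 j)) e2 -!natr1; ring.
Qed.

(** Thales: x and y are at distance 1 from a common point z, and the points k
    times farther from z on the same rays are at distance k * (1 / k) = 1. *)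
Lemma preserves_inv_nat (R : realType) n (f : 'rV[R]_n -> 'rV[R[i]]_n) k :
  (2 <= n)%N -> midpoint_preserving f -> preserves f 1 -> (0 < k)%N ->
  preserves f (k%:R ^- 2).
Proof.
move=> n2 mid f1 k0 x y xy.
have kR : 0 < k%:R :> R by rewrite ltr0n.
have kR0 : k%:R != 0 :> R by rewrite gt_eqF.
have kC0 : k%:R != 0 :> R[i] by rewrite pnatr_eq0 -lt0n.
have [|||z [zx zy]] := @triangle_exists R n x y k%:R^-1 1 1 n2.
- by rewrite invr_gt0.
- by rewrite xy exprVn.
- have k1 : k%:R^-1 <= 1 :> R by rewrite invf_le1 // ler1n.
  have : k%:R^-1 ^+ 2 <= 1 :> R by rewrite exprn_ile1 // invr_ge0 ltW.
  have : 0 <= k%:R^-1 ^+ 2 :> R by exact: sqr_ge0.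
  nra.
have steps t : sq (z - t) = 1 ->
    f (z + k%:R *: (t - z)) - f z = k%:R *: (f t - f z).
  move=> zt; rewrite integer_steps // 1?sqBC // [z + _]addrC.
  by rewrite subrK.
have := f1 (z + k%:R *: (x - z)) (z + k%:R *: (y - z)).
have -> : z + k%:R *: (x - z) - (z + k%:R *: (y - z)) = k%:R *: (x - y).
  by apply/rowP => j; rewrite !mxE; ring.
have -> : f (z + k%:R *: (x - z)) - f (z + k%:R *: (y - z)) =
    k%:R *: (f x - f y).
  rewrite -[f (z + k%:R *: (x - z))](subrK (f z)) steps //.
  rewrite -[f (z + k%:R *: (y - z))](subrK (f z)) steps //.
  by apply/rowP => j; rewrite !mxE; ring.
rewrite !sqZ xy => H.
apply: (@mulfI _ (k%:R ^+ 2)); first by rewrite expf_neq0.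
by rewrite H ?divff ?expf_neq0 // fmorphV rmorphXn rmorph_nat divff ?expf_neq0.
Qed.

(** The map y |-> k f (y / k) again preserves the unit distance, so
    [integer_steps] for it describes f along steps of length 1 / k. *)
Lemma rational_steps (R : realType) n (f : 'rV[R]_n -> 'rV[R[i]]_n) z w m k :
  (2 <= n)%N -> continuousRC f -> preserves f 1 -> (0 < k)%N -> sq w = 1 ->
  f (z + (m%:R / k%:R) *: w) - f z = (m%:R / k%:R) *: (f (z + w) - f z).
Proof.
move=> n2 fc f1 k0 sw.
have kR0 : k%:R != 0 :> R by rewrite pnatr_eq0 -lt0n.
have kC0 : k%:R != 0 :> R[i] by rewrite pnatr_eq0 -lt0n.
have mid := unit_midpoint n2 fc f1.
pose g := rescale k%:R^-1 f.
have g1 : preserves g 1.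
  apply/preserves_rescale; first by rewrite invr_eq0.
  by rewrite mulr1 exprVn; apply: preserves_inv_nat.
have gmid : midpoint_preserving g.
  by apply: unit_midpoint => //; apply: continuous_rescale.
have step j : f (z + (j%:R / k%:R) *: w) - f z =
    j%:R *: (f (z + k%:R^-1 *: w) - f z).
  have := @integer_steps _ _ g (k%:R *: z) w j gmid sw.
  rewrite /g /rescale invrK rmorph_nat -!scalerBr.
  rewrite [in RHS]scalerA [j%:R * k%:R]mulrC -[in RHS]scalerA => /(scalerI kC0).
  by rewrite !scalerDr !scalerA mulVf // !scale1r -!scalerDr [_^-1 * j%:R]mulrC.
rewrite step; have := step k; rewrite divff // scale1r => ->.
by rewrite scalerA divfK.
Qed.

(** Both sides are continuous in t and agree at the positive rationals. *)
Lemma line_affine (R : realType) n (f : 'rV[R]_n -> 'rV[R[i]]_n) z w (t : R) :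
  (2 <= n)%N -> continuousRC f -> preserves f 1 -> 0 <= t -> sq w = 1 ->
  f (z + t *: w) - f z = t%:C *: (f (z + w) - f z).
Proof.
move=> n2 fc f1 t0 sw; apply/rowP => k; apply/eqP; rewrite -subr_eq0; apply/eqP.
pose h (s : R) : R[i]^o :=
  f (z + s *: w) 0 k - f z 0 k - s%:C *: (f (z + w) 0 k - f z 0 k : R[i]^o).
suff : h t = 0 by rewrite /h !mxE.
have hq (q : rat) : 0 < q -> h (ratr q) = 0.
  move=> q0.
  have := @rational_steps _ _ f z w `|numq q|%N `|denq q|%N n2 fc f1 _ sw.
  rewrite absz_gt0 denq_eq0 => /(_ isT).
  have E (F : numFieldType) : `|numq q|%N%:R / `|denq q|%N%:R = ratr q :> F.
    by rewrite /ratr !natr_absz !ger0_norm // numq_ge0 ltW.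
  rewrite !E => /rowP/(_ k); rewrite /h !mxE => ->.
  by rewrite fmorph_rat -[_ *: _]/(_ * _) subrr.
have hc : continuous h.
  move=> s; apply: cvgB.
    apply: cvgB; last exact: cvg_cst.
    apply: (cvg_comp (fun s => z + s *: w) (fun x => f x 0 k : R[i]^o)).
      by apply: cvgD; [exact: cvg_cst | apply: cvgZr_tmp; exact: cvg_id].
    exact: continuous_coord.
  apply: (@cvgZr_tmp _ R[i]^o).
  apply/cvgrPdist_lt => e; rewrite ltcE /= => /andP[/eqP e0 e1].
  near=> s'.
  rewrite -rmorphB normc_def /= expr0n addr0 sqrtr_sqr ltcE /= -e0 eqxx /=.
  by near: s'; apply: (@cvgr_dist_lt _ _ _ (nbhs s)).
apply/eqP; apply: contraT => ht.
have /nbhs_ballP[e /= e0 be] : \forall s \near t, h s != 0.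
  by apply: (@cvgr_neq0 _ R[i]^o _ (nbhs t) _ h (h t) (hc t) ht).
have [|q] := @rat_in_itvoo R t (t + e); first by rewrite ltrDl.
rewrite in_itv /= => /andP[tq qe].
have := be (ratr q); rewrite /= hq ?eqxx; last first.
  by rewrite -(ltr0q R) (le_lt_trans t0).
apply; rewrite /ball /= ler0_norm ?subr_le0 ?ltW // opprB ltrBlDl //.
Unshelve. all: by end_near. Qed.

End Continuity.

Theorem theorem3 (R : realType) (n : nat) (hn : (2 <= n)%N)
    (f : 'rV[R]_n -> 'rV[R[i]]_n)
    (hunit : preserves_unit_distance f) (hcont : continuousRC f) :
  forall x y : 'rV[R]_n,
    phi (f x) (f y) = phi (toC x) (toC y) /\
    phi (toC x) (toC y) = (enorm (x - y) ^+ 2)%:C.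
Proof.
have phi_sq (x y : 'rV[R[i]]_n) : phi x y = sq (x - y).
  by apply: eq_bigr => k _; rewrite !mxE expr2.
have toC_sq (x y : 'rV[R]_n) : phi (toC x) (toC y) = (sq (x - y))%:C.
  rewrite rmorph_sum; apply: eq_bigr => k _.
  by rewrite !mxE -rmorphB -expr2 rmorphXn.
have f1 : preserves f 1.
  by move=> x y xy; rewrite -phi_sq hunit // toC_sq xy.
move=> x y; rewrite phi_sq toC_sq; split; last first.
  rewrite /enorm sqr_sqrtr; last by apply: sumr_ge0 => k _; rewrite sqr_ge0.
  by congr (_%:C); apply: eq_bigr => k _; rewrite expr2.
have [->|xy] := eqVneq x y.
  by rewrite !subrr /sq /dot !big1 // => k _; rewrite mxE mul0r.
pose t := Num.sqrt (sq (x - y)).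
have t2 : t ^+ 2 = sq (x - y) by rewrite sqr_sqrtr // sq_ge0.
have t0 : 0 < t by rewrite sqrtr_gt0 lt_def sq_ge0 sq_eq0 subr_eq0 xy.
pose w := t^-1 *: (x - y).
have sw : sq w = 1 by rewrite sqZ -t2 exprVn mulVf // expf_neq0 // gt_eqF.
have -> : f x - f y = t%:C *: (f (y + w) - f y).
  rewrite -line_affine ?ltW // /w scalerA divff ?gt_eqF // scale1r.
  by rewrite [y + _]addrC subrK.
by rewrite sqZ f1 ?mulr1 -?t2 ?rmorphXn // addrAC subrr add0r.
Qed.
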